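(* Let $\mathscr{I}$ be a non-empty set. For each $i\in\mathscr{I}$ let $\lambda_i\geqslant 1$ be a cardinal, let $S_i$ be a semiregular pseudocompact semitopological monoid with zero, and let $B^0_{\lambda_i}(S_i)$ be a semiregular pseudocompact topological Brandt $\lambda_i^0$-extension of $S_i$. Suppose that the Tychonoff product $\prod\{S_i\colon i\in\mathscr{I}\}$ is a pseudocompact space. Then the direct product $\prod\{B^0_{\lambda_i}(S_i)\colon i\in\mathscr{I}\}$ with the Tychonoff topology is a semiregular pseudocompact semitopological semigroup.
   Context: All topological spaces are Hausdorff. A semitopological semigroup is a Hausdorff topological space with a separately continuous associative operation; a semitopological monoid is a semitopological semigroup with identity. Direct products of semigroups carry the coordinatewise operation. Brandt $\lambda^0$-extension: for a monoid $S$ with zero $0_S$ and a cardinal $\lambda\geqslant 1$, $B^0_\lambda(S)$ is the set $\{(\alpha,s,\beta)\colon \alpha,\beta\in\lambda,\ s\in S\setminus\{0_S\}\}\sqcup\{0\}$ with the operation in which $0$ is the zero and $(\alpha,a,\beta)\cdot(\gamma,b,\delta)$ equals $(\alpha,ab,\delta)$ if $\beta=\gamma$ and $ab\neq 0_S$, and equals $0$ otherwise. For $\alpha,\beta\in\lambda$ put $S_{\alpha,\beta}=\{(\alpha,s,\beta)\colon s\in S\setminus\{0_S\}\}\cup\{0\}$. Topological Brandt $\lambda^0$-extension: for a semitopological monoid $(S,\tau)$ with zero, it is $B^0_\lambda(S)$ with a Hausdorff topology $\tau_B$ such that $(B^0_\lambda(S),\tau_B)$ is a semitopological semigroup and, for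 some $\alpha\in\lambda$, the map $0_S\mapsto 0$, $s\mapsto(\alpha,s,\alpha)$ ($s\neq 0_S$) is a homeomorphism of $(S,\tau)$ onto the subspace $S_{\alpha,\alpha}$. A subset $A$ of a space $X$ is regular open if $\operatorname{int}_X(\operatorname{cl}_X(A))=A$; a space is semiregular if it has a base of regular open subsets. A Hausdorff space is pseudocompact if every locally finite family of non-empty open subsets of it is finite (equivalently, each locally finite open cover is finite); no Tychonoff separation is assumed. *)

(* Defs.v *)
From HB Require Import structures.
From mathcomp Require Import all_boot.
From mathcomp Require Import all_classical.
From mathcomp Require Import topology function_spaces.

Set Implicit Arguments.
Unset Strict Implicit.
Unset Printing Implicit Defensive.

Local Open Scope classical_set_scope.
Local Open Scope group_scope.

Section spaces.
Variable X : topologicalType.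

Definition semiregular := exists2 B : set_system X, B `<=` @regopen X & basis B.

Definition locally_finite (F : set_system X) := forall x : X,
  exists2 V, nbhs x V & finite_set [set U | F U /\ U `&` V !=set0].

(* No separation is built in: Hausdorffness is a separate hypothesis. *)
Definition pseudocompact := forall F : set_system X,
  (forall U, F U -> open U /\ U !=set0) -> locally_finite F -> finite_set F.

End spaces.

Definition homeomorphism (X Y : topologicalType) (f : X -> Y) :=
  continuous f /\ exists g : Y -> X, [/\ continuous g, cancel f g & cancel g f].

(* An arbitrary topology on a fixed carrier; [topologized tau] is the carrier
   endowed with it. *)
Record topology_on (T : Type) := TopologyOn {
  topology_open : set_system T ;
  topology_openT : topology_open setT ;
  topology_openI : setI_closed topology_open ;
  topology_bigcup : forall (I : Type) (f : I -> set T),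
    (forall i, topology_open (f i)) -> topology_open (\bigcup_i f i)
}.

Definition topologized (T : Type) (tau : topology_on T) : Type := T.

HB.instance Definition _ (T : choiceType) (tau : topology_on T) :=
  Choice.copy (topologized tau) T.

HB.instance Definition _ (T : choiceType) (tau : topology_on T) :=
  isOpenTopological.Build (topologized tau)
    (topology_openT tau) (@topology_openI _ tau) (@topology_bigcup _ tau).

Lemma open_topologized (T : choiceType) (tau : topology_on T)
    (A : set (topologized tau)) : open A <-> topology_open tau A.
Proof.
split; last first.
  by move=> tA; rewrite openE => x Ax; exists A; split.
rewrite openE => H.
have -> : A = \bigcup_(B : {B : set T | topology_open tau B /\ B `<=` A}) (sval B).
  apply/seteqP; split => [x Ax|x [[B [tB BA]] _ /= Bx]]; last exact: BA.
  by have [B [tB Bx BA]] := H x Ax; exists (exist _ B (conj tB BA)).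
by apply: topology_bigcup => -[B []].
Qed.

(* Only a join: no compatibility between operation and topology. *)
#[short(type="preTopologicalSemigroupType")]
HB.structure Definition PreTopologicalSemigroup :=
  {G of Topological G & Semigroup G}.

Definition separately_continuous (G : preTopologicalSemigroupType) :=
  forall a : G, continuous (fun x : G => a * x) /\
                continuous (fun x : G => x * a).

Definition semitopological (G : preTopologicalSemigroupType) :=
  hausdorff_space G /\ separately_continuous G.

HB.mixin Record Monoid_hasZero S of Monoid S := {
  zerog : S ;
  mul0g : left_zero zerog (@mul S) ;
  mulg0 : right_zero zerog (@mul S)
}.

#[short(type="monoid0Type")]
HB.structure Definition Monoid0 := {S of Monoid_hasZero S & Monoid S}.

#[short(type="preTopologicalMonoid0Type")]
HB.structure Definition PreTopologicalMonoid0 :=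
  {S of Topological S & Monoid0 S}.

HB.instance Definition _ (G : semigroupType) (tau : topology_on G) :=
  Semigroup.copy (topologized tau) G.

Section product_semigroup.
Variables (I : Type) (G : I -> preTopologicalSemigroupType).

Definition prod_mul (x y : prod_topology G) : prod_topology G :=
  fun i => x i * y i.

Lemma prod_mulA : associative prod_mul.
Proof. by move=> x y z; apply: functional_extensionality_dep => i; exact: mulgA. Qed.

HB.instance Definition _ := isSemigroup.Build (prod_topology G) prod_mulA.

End product_semigroup.

(* The cardinal is given by a type [L] of that cardinality. *)
Inductive brandt (L : Type) (S : monoid0Type) :=
| BrandtZero
| BrandtElt of L & {s : S | s != zerog} & L.
Arguments BrandtZero {L S}.

HB.instance Definition _ (L : Type) (S : monoid0Type) :=
  gen_eqMixin (brandt L S).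
HB.instance Definition _ (L : Type) (S : monoid0Type) :=
  gen_choiceMixin (brandt L S).

Section brandt_semigroup.
Variables (L : Type) (S : monoid0Type).

(* [(a, s, b)], read as the zero of the extension when [s] is the zero of [S]. *)
Definition brandt_elt (a : L) (s : S) (b : L) : brandt L S :=
  if insub s is Some u then BrandtElt a u b else BrandtZero.

Definition brandt_mul (x y : brandt L S) : brandt L S :=
  match x, y with
  | BrandtElt a s b, BrandtElt c t d =>
      if `[< b = c >] then brandt_elt a (val s * val t) d else BrandtZero
  | _, _ => BrandtZero
  end.

Definition brandt_block (a b : L) : set (brandt L S) :=
  [set brandt_elt a s b | s in [set s : S | s != zerog]] `|` [set BrandtZero].

Lemma brandt_elt0 a b : brandt_elt a zerog b = BrandtZero.
Proof. by rewrite /brandt_elt insubF ?eqxx. Qed.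

Lemma brandt_eltE a (s : {s : S | s != zerog}) b :
  brandt_elt a (val s) b = BrandtElt a s b.
Proof. by rewrite /brandt_elt valK. Qed.

Lemma brandt_mulE a s b c t d :
  brandt_mul (brandt_elt a s b) (brandt_elt c t d) =
  if `[< b = c >] then brandt_elt a (s * t) d else BrandtZero.
Proof.
have [->|s0] := eqVneq s zerog; first by rewrite mul0g !brandt_elt0 if_same.
have [->|t0] := eqVneq t zerog.
  by rewrite mulg0 !brandt_elt0 if_same; case: brandt_elt.
by rewrite -[s]/(val (exist (fun s => s != zerog) s s0))
           -[t]/(val (exist (fun s => s != zerog) t t0)) !brandt_eltE.
Qed.

Lemma brandt_mul0 x : brandt_mul x BrandtZero = BrandtZero.
Proof. by case: x. Qed.

Lemma brandt_mulA : associative brandt_mul.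
Proof.
move=> [|a s b] // [|c t d]; first by rewrite !brandt_mul0.
case=> [|e u f]; first by rewrite !brandt_mul0.
rewrite -!brandt_eltE !brandt_mulE.
case: (asboolP (d = e)) => [de|nde]; case: (asboolP (b = c)) => [bc|nbc];
  rewrite ?brandt_mul0 ?brandt_mulE //.
- by rewrite (asboolT bc) (asboolT de) mulgA.
- by rewrite asboolF.
- by rewrite asboolF.
Qed.

HB.instance Definition _ := isSemigroup.Build (brandt L S) brandt_mulA.

End brandt_semigroup.

Definition topological_brandt (L : Type) (S : preTopologicalMonoid0Type)
    (tau : topology_on (brandt L S)) :=
  semitopological (topologized tau) /\
  exists (a : L) (f : S -> (brandt_block a a : set (topologized tau))),
    homeomorphism f /\ forall s, val (f s) = brandt_elt a s a.

(* Main.v *)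
Require Import Defs.
From mathcomp Require Import all_boot.
From mathcomp Require Import all_classical.
From mathcomp Require Import topology function_spaces.
Set Implicit Arguments.
Unset Strict Implicit.
Unset Printing Implicit Defensive.
Local Open Scope classical_set_scope.

(** Separate continuity, the Hausdorff property and semiregularity all pass to
Tychonoff products coordinatewise; pseudocompactness does not, and is the point
of the theorem.

In a topological Brandt extension [B] of [S], multiplying on both sides by
idempotents [(b, 1, b)] and [(c, 1, c)] retracts [B] continuously onto the
block [S_{b,c}], so each block without its zero is open.  These punctured blocks
are pairwise disjoint, and pseudocompactness then forces the closure of any
neighbourhood of the zero to contain all but finitely many of them;
semiregularity replaces the closure by the neighbourhood itself
([nbhs_brandt_zero]).

Hence the topology of [B] is so coarse at the zero that [B] is a continuous
image of a product [A * S], where [A] is the one-point compactification of the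
discrete space of pairs of indices: [((b, c), s)] goes to [(b, s, c)] and the
whole slice over the point at infinity goes to the zero
([brandt_chart_continuous]).

Taking products, the product of the extensions is a continuous image of the
product of the [S_i] with the product of the compact spaces [A_i].  The former
factor is pseudocompact by assumption, the latter is compact by Tychonoff's
theorem, the product of a pseudocompact space with a compact one is
pseudocompact ([pseudocompact_setX]), and so is a continuous image of it
([pseudocompact_image]). *)

(** * Tychonoff products *)

Section product.
Variables (I : Type) (K : I -> topologicalType).

Lemma prod_proj_continuous (i : I) :
  continuous (fun x : prod_topology K => x i).
Proof. exact: (@proj_continuous {classic I} K i). Qed.

Lemma cvg_prod (F : set_system (prod_topology K)) (x : prod_topology K) :
  Filter F -> (forall i, (fun y : prod_topology K => y i) @ F --> x i) ->
  F --> x.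
Proof.
move=> FF Fx; apply/cvg_sup => i A [_ [[U oU <-] Ux UA]].
by apply: filterS UA _; apply: Fx; exact: open_nbhs_nbhs.
Qed.

Lemma continuous_prod (T : topologicalType) (f : T -> prod_topology K) :
  (forall i, continuous (fun t => f t i)) -> continuous f.
Proof. by move=> fc t; apply: cvg_prod => i; exact: fc. Qed.

Lemma hausdorff_prod :
  (forall i, hausdorff_space (K i)) -> hausdorff_space (prod_topology K).
Proof. exact: (@hausdorff_product {classic I} K). Qed.

Lemma compact_prod : (forall i, compact [set: K i]) ->
  compact [set: prod_topology K].
Proof.
move=> Kc; have := @tychonoff {classic I} K (fun=> setT) Kc.
by congr (compact _); apply/seteqP.
Qed.

End product.

Lemma semitopological_prod (I : Type) (G : I -> preTopologicalSemigroupType) :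
  (forall i, semitopological (G i)) -> semitopological (prod_topology G).
Proof.
move=> Gs; split; first by apply: hausdorff_prod => i; case: (Gs i).
move=> a; split; apply: continuous_prod => i x.
- apply: (@continuous_comp _ _ _ (fun x : prod_topology G => x i)
    (fun y : G i => (a i * y)%g)); first exact: prod_proj_continuous.
  exact: ((Gs i).2 (a i)).1.
- apply: (@continuous_comp _ _ _ (fun x : prod_topology G => x i)
    (fun y : G i => (y * a i)%g)); first exact: prod_proj_continuous.
  exact: ((Gs i).2 (a i)).2.
Qed.

(** * Semiregularity of products *)

(** Semiregularity says that these sets include all neighbourhoods of [x].
Stating it as the convergence of a filter lets it be checked one coordinate at a
time in a product. *)
Definition regular_nbhs (X : topologicalType) (x : X) : set_system X :=
  [set U | exists2 V, nbhs x V & (closure V)° `<=` U].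

Lemma regular_nbhs_filter (X : topologicalType) (x : X) :
  Filter (regular_nbhs x).
Proof.
split; first by exists setT => //; exact: filterT.
- move=> A B [V xV VA] [W xW WB]; exists (V `&` W); first exact: filterI.
  apply: subset_trans (interiorS (@closureI _ V W)) _.
  by rewrite interiorI => y [/VA ? /WB ?].
- by move=> A B AB [V xV VA]; exists V => // y /VA /AB.
Qed.

Lemma semiregularP (X : topologicalType) :
  semiregular X <-> forall x : X, regular_nbhs x --> x.
Proof.
split=> [[B Breg [Bo Bx]] x U /Bx[V [BV Vx] VU]|regX].
  exists V; last by rewrite (Breg _ BV).
  by apply: open_nbhs_nbhs; split=> //; exact: Bo.
exists (@regopen X) => //; split=> [U <-|x U /regX[V xV VU]].
  exact: open_interior.
exists (closure V)° => //; split; first exact: interior_closure_idem.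
exact/interiorS/xV/subset_closure.
Qed.

Lemma semiregular_prod (I : Type) (K : I -> topologicalType) :
  (forall i, semiregular (K i)) -> semiregular (prod_topology K).
Proof.
move=> Kreg; apply/semiregularP => x.
apply: cvg_prod => [|i U]; first exact: regular_nbhs_filter.
move=> /((semiregularP _).1 (Kreg i))[V xV VU].
pose p (y : prod_topology K) := y i.
exists (p @^-1` V); first exact: prod_proj_continuous.
(* An open [O] inside the closure of the cylinder over [V] projects onto an open
   set, which lies inside the closure of [V]. *)
move=> y; rewrite /interior nbhsE => -[O [oO Oy] Ocl]; apply: VU.
apply: (@filterS _ _ _ (p @` O)); last first.
  apply: open_nbhs_nbhs; split; last by exists y.
  exact: (@proj_open {classic I} K i).
move=> _ [z /Ocl zV <-] W zW.
by have [w [Vw Ww]] := zV _ (@prod_proj_continuous _ K i z W zW); exists (w i).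
Qed.

(** * Pseudocompactness of images and of products with a compact space *)

(** By surjectivity, taking preimages is an injection of families of sets, and
it preserves local finiteness. *)
Lemma pseudocompact_image (X Y : topologicalType) (f : X -> Y) :
  continuous f -> (forall y, exists x, f x = y) ->
  pseudocompact X -> pseudocompact Y.
Proof.
move=> fc fsurj Xp F Fo Flf.
have fK U : f @` (f @^-1` U) = U.
  apply/seteqP; split=> [_ [x ? <-]//|y Uy].
  by have [x fxy] := fsurj y; exists x => //=; rewrite fxy.
suff : finite_set [set f @^-1` U | U in F].
  move=> /(finite_image (fun V => f @` V)); apply: sub_finite_set => U FU.
  by exists (f @^-1` U); [exists U|exact: fK].
apply: Xp => [_ [U FU <-]|x].
  have [oU [y Uy]] := Fo _ FU; split; first by apply: open_comp => // z _.
  by have [x fxy] := fsurj y; exists x => /=; rewrite fxy.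
have [V xV Vfin] := Flf (f x); exists (f @^-1` V); first exact: fc.
apply: sub_finite_set (finite_image (fun U => f @^-1` U) Vfin).
move=> _ [[U FU <-] [z [Uz Vz]]]; exists U => //; split=> //.
by exists (f z).
Qed.

(** The tube lemma, for finiteness instead of inclusion.  The sets [C] such that
only finitely many members of [F] meet [O `*` ~` C], for some neighbourhood [O]
of [x], form a filter on [K].  A cluster point [k] of it would contradict local
finiteness at [(x, k)], so by compactness the filter is improper; that [set0]
belongs to it is the conclusion. *)
Lemma locally_finite_tube (X K : topologicalType) (F : set_system (X * K)%type)
    (x : X) : compact [set: K] -> locally_finite F ->
  exists2 O, nbhs x O & finite_set [set U | F U /\ U `&` (O `*` setT) !=set0].
Proof.
move=> Kc Flf.
pose G : set_system K := [set C | exists2 O, nbhs x O &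
  finite_set [set U | F U /\ U `&` (O `*` ~` C) !=set0]].
have GF : Filter G.
  split.
  - exists setT; first exact: filterT.
    by apply: sub_finite_set (finite_set0 _) => U [_ [p [_ [_]]]]; exact.
  - move=> C D [O xO Ofin] [P xP Pfin]; exists (O `&` P); first exact: filterI.
    move: (conj Ofin Pfin); rewrite -finite_setU; apply: sub_finite_set.
    move=> U [FU [p [Up [[Op Pp] /not_andP[nC|nD]]]]]; [left|right];
    by split=> //; exists p.
  - move=> C D CD [O xO Ofin]; exists O => //.
    apply: sub_finite_set Ofin => U [FU [p [Up [Op nD]]]].
    by split=> //; exists p; split=> //; split=> // /CD.
have [[O xO Ofin]|nG0] := pselect (G set0).
  by exists O => //; rewrite -setC0.
have [k [_ kG]] := Kc G (Build_ProperFilter nG0 GF) filterT.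
have [W [[O P] /= [xO kP] OPW] Wfin] := Flf (x, k).
have GP : G (~` P).
  exists O => //; rewrite setCK; apply: sub_finite_set Wfin.
  by move=> U [FU [p [Up /OPW Wp]]]; split=> //; exists p.
by have [y []] := kG _ _ GP kP.
Qed.

(** By the tube lemma, the projections to [X] of the members of a locally finite
family [F] form a locally finite family, hence a finite one.  Its fibres are
finite as well: all members of [F] with the same projection meet the tube over
any one point of it. *)
Lemma pseudocompact_setX (X K : topologicalType) :
  pseudocompact X -> compact [set: K] -> pseudocompact (X * K)%type.
Proof.
move=> Xp Kc F Fo Flf.
have tube x := locally_finite_tube x Kc Flf.
have Gfin : finite_set [set fst @` U | U in F].
  apply: Xp => [_ [U FU <-]|x].
    have [oU [p Up]] := Fo _ FU; split; first exact: fst_open.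
    by exists p.1, p.
  have [O xO Ofin] := tube x; exists O => //.
  apply: sub_finite_set (finite_image (fun U => fst @` U) Ofin).
  move=> _ [[U FU <-] [_ [[p Up <-] Op]]]; exists U => //; split=> //.
  by exists p.
suff : finite_set (\bigcup_(V in [set fst @` U | U in F])
    [set U | F U /\ fst @` U = V]).
  by apply: sub_finite_set => U FU; exists (fst @` U) => //; exists U.
apply: bigcup_finite => // _ [U FU <-].
have [_ [p Up]] := Fo _ FU; have [O pO Ofin] := tube p.1.
apply: sub_finite_set Ofin => W [FW WU]; split=> //.
have [q Wq qp] : (fst @` W) p.1 by rewrite WU; exists p.
by exists q; split=> //; split=> //=; rewrite qp; exact: nbhs_singleton.
Qed.

(** * The topology of a Brandt extension *)

Section brandt.
Variables (L : Type) (S : preTopologicalMonoid0Type).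
Variable tau : topology_on (brandt L S).
Notation B := (topologized tau).
Hypothesis Btop : topological_brandt tau.

Let mulB_continuous (x y : B) : continuous (fun z : B => (x * z * y)%g).
Proof.
move=> z; have [[_ sc] _] := Btop.
apply: (@continuous_comp _ _ _ (fun z : B => (x * z)%g)
  (fun z : B => (z * y)%g)); first exact: (sc x).1.
exact: (sc y).2.
Qed.

(** One diagonal block [S_{a,a}] carries the topology of [S] by definition, and
multiplying by [(b, 1, a)] on the left and [(a, 1, c)] on the right moves it to
the block [S_{b,c}]. *)
Lemma brandt_elt_continuous b c :
  continuous (fun s : S => brandt_elt b s c : B).
Proof.
have [_ [a [f [[fc _] fE]]]] := Btop.
have -> : (fun s : S => brandt_elt b s c : B) =
    (fun z : B => (brandt_elt b 1%g a : B) * z * (brandt_elt a 1%g c : B))%g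
    \o (set_val \o f).
  apply/funext => s /=.
  rewrite set_valE fE.
  rewrite -[RHS]/(brandt_mul (brandt_mul (brandt_elt b 1%g a)
    (brandt_elt a s a)) (brandt_elt a 1%g c)).
  by rewrite brandt_mulE asboolT// brandt_mulE asboolT// mul1g mulg1.
move=> s; apply: continuous_comp; last exact: mulB_continuous.
apply: continuous_comp; first exact: fc.
exact: initial_continuous.
Qed.

Definition punctured_block (p : L * L) : set B :=
  [set x | exists u, x = BrandtElt p.1 u p.2].

(** The product [(b, 1, b) * x * (c, 1, c)] is non-zero exactly when [x] lies in
the punctured block, and the zero is a closed point. *)
Lemma punctured_block_open p : open (punctured_block p).
Proof.
case: p => b c.
have -> : punctured_block (b, c) =
   (fun z : B => (brandt_elt b 1%g b : B) * z * (brandt_elt c 1%g c : B))%g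
     @^-1` (~` [set BrandtZero : B]).
  apply/seteqP; split=> x /=.
    move=> [u ->].
    rewrite -[X in X <> _]/(brandt_mul (brandt_mul (brandt_elt b 1%g b)
      (BrandtElt b u c)) (brandt_elt c 1%g c)).
    rewrite -brandt_eltE brandt_mulE asboolT// brandt_mulE asboolT//.
    by rewrite mul1g mulg1 brandt_eltE.
  rewrite -[X in X <> _]/(brandt_mul (brandt_mul (brandt_elt b 1%g b)
      x) (brandt_elt c 1%g c)).
  case: x => [|b' u c']; first by rewrite brandt_mul0.
  rewrite -brandt_eltE brandt_mulE; case: asboolP => [<-|//].
  rewrite brandt_mulE; case: asboolP => [->|//] _.
  by exists u; rewrite brandt_eltE.
apply: open_comp; first by move=> x _; exact: mulB_continuous.
apply: closed_openC; apply: accessible_closed_set1.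
by apply: hausdorff_accessible; have [[]] := Btop.
Qed.

Hypothesis Breg : semiregular B.
Hypothesis Bpc : pseudocompact B.

(** For [V] a neighbourhood of the zero, the non-empty traces of the punctured
blocks on the complement of the closure of [V] are locally finite: [V] misses
all of them, and each punctured block meets at most one.  So there are finitely
many of them, and any other punctured block lies in the closure of [V], hence in
its interior, being open. *)
Lemma nbhs_brandt_zero (W : set B) : nbhs (BrandtZero : B) W ->
  finite_set [set p : L * L | ~ punctured_block p `<=` W].
Proof.
move=> /((semiregularP B).1 Breg)[V V0 VW].
pose R p := punctured_block p `\` closure V.
have R_inj : set_inj [set p | R p !=set0] R.
  move=> [b c] [b' c'] /set_mem[x Rx] _ Rp.
  have [[u /= xbc] _] := Rx.
  have [[v /= xbc'] _] : R (b', c') x by rewrite -Rp.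
  by move: xbc'; rewrite xbc => -[-> _ ->].
have Rfin : finite_set [set R p | p in [set p | R p !=set0]].
  apply: Bpc => [_ [p Rp <-]|x].
    split=> //; apply: openI; first exact: punctured_block_open.
    exact/closed_openC/closed_closure.
  case: x => [|b u c].
    exists V => //; apply: sub_finite_set (finite_set0 _).
    by move=> _ [[p _ <-] [y [[_ +] Vy]]]; apply; exact: subset_closure.
  exists (punctured_block (b, c)).
    apply: open_nbhs_nbhs; split; first exact: punctured_block_open.
    by exists u.
  apply: sub_finite_set (finite_set1 (R (b, c))).
  move=> _ [[[b' c'] _ <-] [y [[[v /= ->] _] [w /= [-> _ ->]]]]].
  by [].
have : finite_set [set p | R p !=set0].
  by move: Rfin; rewrite (eq_finite_set (inj_card_eq R_inj)).
apply: sub_finite_set => p /= npW; apply: contrapT => Rp0; apply: npW.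
apply: subset_trans VW; rewrite -open_subsetE; last first.
  exact: punctured_block_open.
by move=> x px; apply: contrapT => nVx; apply: Rp0; exists x.
Qed.

Definition index_space := one_point_compactification
  (discrete_topology {classic (L * L)%type}).

(** [None], the point at infinity, accounts for the zero of [B], at which the
blocks accumulate. *)
Definition brandt_chart (q : index_space * S) : B :=
  if q.1 is Some p then brandt_elt p.1 q.2 p.2 else BrandtZero.

Lemma brandt_chart_surj x : exists q, brandt_chart q = x.
Proof.
case: x => [|b u c]; first by exists (None, 1%g).
by exists (Some (b, c), val u); exact: brandt_eltE.
Qed.

Lemma brandt_chart_continuous : continuous brandt_chart.
Proof.
move=> [[[b c]|] s] W /= nW.
- exists (Some @` [set (b, c)], (fun s : S => brandt_elt b s c : B) @^-1` W).
    split=> /=; last exact: brandt_elt_continuous.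
    apply: one_point_compactification_some_nbhs.
    exact: (@discrete_set1 (discrete_topology {classic (L * L)%type})).
  by move=> [q t] [/= [_ -> <-] Wt].
(* The blocks not included in [W] are indexed by a finite, hence compact, set,
   whose complement together with [None] is a neighbourhood of [None]. *)
- have W0 : W BrandtZero := nbhs_singleton nW.
  pose N : set (discrete_topology {classic (L * L)%type}) :=
    [set p | ~ punctured_block p `<=` W].
  exists ((Some @` (~` N)) `|` [set None], setT).
    split; last exact: filterT.
    exists N => //; split; last exact: discrete_closed.
    by apply: finite_compact; exact: nbhs_brandt_zero.
  move=> [q t] /= [[[[b c] NE <-]|->] _] //.
  rewrite /brandt_chart /=; have [->|t0] := eqVneq t zerog.
    by rewrite brandt_elt0.
  move/contrapT : NE; apply.
  by exists (exist _ t t0); rewrite -brandt_eltE.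
Qed.

End brandt.

(** * Products of Brandt extensions *)

Theorem theorem2p12 (I : Type) (L : I -> Type)
    (S : I -> preTopologicalMonoid0Type)
    (tau : forall i, topology_on (brandt (L i) (S i))) :
  inhabited I ->
  (forall i, inhabited (L i)) ->
  (forall i, [/\ semitopological (S i), semiregular (S i)
                & pseudocompact (S i)]) ->
  (forall i, [/\ topological_brandt (tau i), semiregular (topologized (tau i))
                & pseudocompact (topologized (tau i))]) ->
  pseudocompact (prod_topology S) ->
  [/\ semitopological (prod_topology (fun i => topologized (tau i))),
      semiregular (prod_topology (fun i => topologized (tau i)))
    & pseudocompact (prod_topology (fun i => topologized (tau i)))].
Proof.
move=> _ _ _ HB Sp; split.
- by apply: semitopological_prod => i; have [[]] := HB i.
- by apply: semiregular_prod => i; have [] := HB i.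
pose A i : topologicalType := index_space (L i).
pose f (q : prod_topology S * prod_topology A) :
  prod_topology (fun i => topologized (tau i)) :=
  fun i => brandt_chart (tau i) (q.2 i, q.1 i).
apply: (@pseudocompact_image _ _ f).
- apply: continuous_prod => i q; have [Btop Breg Bpc] := HB i.
  apply: (@continuous_comp _ _ _
    (fun q : prod_topology S * prod_topology A => (q.2 i, q.1 i))
    (brandt_chart (tau i))); last exact: brandt_chart_continuous.
  have q1c : (fun q : prod_topology S * prod_topology A => q.1 i) @ q --> q.1 i.
    apply: (@continuous_comp _ _ _ fst (fun x : prod_topology S => x i)).
      exact: cvg_fst.
    exact: prod_proj_continuous.
  have q2c : (fun q : prod_topology S * prod_topology A => q.2 i) @ q --> q.2 i.
    apply: (@continuous_comp _ _ _ snd (fun x : prod_topology A => x i)).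
      exact: cvg_snd.
    exact: prod_proj_continuous.
  exact: cvg_pair q2c q1c.
- move=> y; pose q i := sval (cid (brandt_chart_surj (y i))).
  have qE i : brandt_chart (tau i) (q i) = y i by rewrite /q; case: cid.
  exists ((fun i => (q i).2), (fun i => (q i).1)).
  apply: functional_extensionality_dep => i.
  by rewrite /f /= -surjective_pairing.
apply: pseudocompact_setX => //; apply: compact_prod => i.
exact: one_point_compactification_compact.
Qed.
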